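(* Let $\mathbf M=(M,+,\cdot,\vec 0)$ be a module over a unitary commutative ring $(S,+,\cdot,0,1)$ with a fixed basis $(\vec b_i)_{i\in I}$. Then $\mathbf{Pr}(\mathbf M)=(\mathrm{Pr}(\mathbf M),\leq,{}',\mathbf 0,\mathbf I)$ is an orthomodular poset, $\mathbf L_s(\mathbf M)=(L_s(\mathbf M),\subseteq,{}^\perp,\{\vec 0\},M)$ is isomorphic to $\mathbf{Pr}(\mathbf M)$ (as a bounded poset with unary operation), and for all $U,W\in L_s(\mathbf M)$ with $U\perp W$ (i.e. $U\subseteq W^\perp$) the supremum $U\vee W$ in $\mathbf L_s(\mathbf M)$ exists and $U\vee W=U+W$.
   Context: Basis: a family $(\vec b_i)_{i\in I}$ of elements of $M$, $I$ a non-empty set, such that for every $\vec x\in M$ there is exactly one function $f:I\to S$ with $f(i)=0$ for all but finitely many $i$ and $\sum_{i\in I}f(i)\vec b_i=\vec x$; the coordinates of $\vec x$ are $x_i:=f(i)$. The inner product is $\vec x\vec y:=\sum_{i\in I}x_iy_i\in S$. Write $\vec x\perp\vec y$ if $\vec x\vec y=0$, and for $C\subseteq M$ put $C^\perp:=\{\vec x\in M\mid\vec x\perp\vec y\text{ for all }\vec y\in C\}$. A submodule $U$ of $\mathbf M$ is called splitting if $U+U^\perp=M$ and $U\cap U^\perp=\{\vec 0\}$, where $U+W:=\{\vec x+\vec y\mid \vec x\in U,\vec y\in W\}$. $L_s(\mathbf M)$ is the set of all splitting submodules. A projection of $\mathbf M$ is a linear mapping $P:M\to M$ with $P\circ P=P$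 and $(P\vec x)\vec y=\vec x(P\vec y)$ for all $\vec x,\vec y\in M$. $\mathrm{Pr}(\mathbf M)$ is the set of all projections, with $P\leq Q$ defined as $P(M)\subseteq Q(M)$. $\mathbf 0$ is the constant mapping with value $\vec 0$, $\mathbf I$ the identity mapping on $M$, and $P':=\mathbf I-P$. An orthomodular poset is a bounded poset $(X,\leq,{}',0,1)$ with an antitone involution $'$ (that is, $x\leq y$ implies $y'\leq x'$, and $x''=x$) such that for all $x,y\in X$: the supremum $x\vee y$ exists if $x\leq y'$, and if $x\leq y$ then $y=x\vee(y\wedge x')$ (the infimum and supremum involved then exist). *)

(* Defs.v *)
From mathcomp Require Import all_boot all_order all_algebra.
From mathcomp Require Import all_classical.

Set Implicit Arguments.
Unset Strict Implicit.
Unset Printing Implicit Defensive.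

Import GRing.Theory.
Local Open Scope classical_set_scope.
Local Open Scope ring_scope.

Section Module.
Context {S : comPzRingType} {M : lmodType S} {I : choiceType}.
Implicit Types (b : I -> M) (x y : M) (C U W : set M) (P : M -> M).

Definition coord_family b x (f : I -> S) : Prop :=
  finite_set [set i | f i != 0] /\ \sum_(i \in [set: I]) f i *: b i = x.

Definition is_basis b : Prop :=
  [set: I] !=set0 /\ forall x, exists! f : I -> S, coord_family b x f.

(* The default value 0 of xget is irrelevant when b is a basis. *)
Definition basis_coord b x : I -> S := xget (fun=> 0) [set f | coord_family b x f].

Definition inner b x y : S := \sum_(i \in [set: I]) basis_coord b x i * basis_coord b y i.

Definition orth b C : set M := [set x | forall y, C y -> inner b x y = 0].

Definition addset U W : set M := [set x + y | x in U & y in W].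

Definition splitting b U : Prop :=
  [/\ submod_closed (mem U),
      addset U (orth b U) = [set: M] &
      U `&` orth b U = [set 0]].

Definition projection b P : Prop :=
  [/\ linear P, P \o P = P & forall x y, inner b (P x) y = inner b x (P y)].

End Module.

(* A set with an order relation, a unary operation and two constants. Only the
   behaviour on the carrier is relevant; that the carrier contains the constants
   and is stable under the operation is part of [bounded_poset]. *)
Record oposet (T : Type) := OPoset {
  carrier : set T;
  ole : T -> T -> Prop;
  ocompl : T -> T;
  obot : T;
  otop : T }.

Section Posets.
Context {T : Type}.
Implicit Types (X : oposet T).

Record bounded_poset X : Prop := BoundedPoset {
  obot_in : carrier X (obot X);
  otop_in : carrier X (otop X);
  ocompl_in : forall x, carrier X x -> carrier X (ocompl X x);
  ole_refl : forall x, carrier X x -> ole X x x;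
  ole_anti : forall x y, carrier X x -> carrier X y ->
    ole X x y -> ole X y x -> x = y;
  ole_trans : forall x y z, carrier X x -> carrier X y -> carrier X z ->
    ole X x y -> ole X y z -> ole X x z;
  obot_le : forall x, carrier X x -> ole X (obot X) x;
  otop_ge : forall x, carrier X x -> ole X x (otop X) }.

Definition is_join X (x y z : T) : Prop :=
  [/\ carrier X z, ole X x z, ole X y z &
      forall w, carrier X w -> ole X x w -> ole X y w -> ole X z w].

Definition is_meet X (x y z : T) : Prop :=
  [/\ carrier X z, ole X z x, ole X z y &
      forall w, carrier X w -> ole X w x -> ole X w y -> ole X w z].

Record orthomodular_poset X : Prop := OrthomodularPoset {
  omp_bounded : bounded_poset X;
  omp_antitone : forall x y, carrier X x -> carrier X y ->
    ole X x y -> ole X (ocompl X y) (ocompl X x);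
  omp_involutive : forall x, carrier X x -> ocompl X (ocompl X x) = x;
  omp_join : forall x y, carrier X x -> carrier X y ->
    ole X x (ocompl X y) -> exists z, is_join X x y z;
  omp_modular : forall x y, carrier X x -> carrier X y -> ole X x y ->
    exists2 m, is_meet X y (ocompl X x) m & is_join X x m y }.

End Posets.

Definition oposet_iso {T T' : Type} (X : oposet T) (Y : oposet T') : Prop :=
  exists phi : T -> T',
    [/\ set_bij (carrier X) (carrier Y) phi,
        forall x y, carrier X x -> carrier X y ->
          (ole X x y <-> ole Y (phi x) (phi y)),
        forall x, carrier X x -> phi (ocompl X x) = ocompl Y (phi x),
        phi (obot X) = obot Y &
        phi (otop X) = otop Y].

Section Structures.
Context {S : comPzRingType} {M : lmodType S} {I : choiceType}.

Definition Pr (b : I -> M) : oposet (M -> M) :=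
  {| carrier := [set P | projection b P];
     ole := fun P Q => range P `<=` range Q;
     ocompl := fun P => idfun \- P;
     obot := fun=> 0;
     otop := idfun |}.

Definition Ls (b : I -> M) : oposet (set M) :=
  {| carrier := [set U | splitting b U];
     ole := fun U W => U `<=` W;
     ocompl := orth b;
     obot := [set 0];
     otop := [set: M] |}.

End Structures.

(* Main.v *)
Require Import Defs.
From mathcomp Require Import all_boot all_order all_algebra.
From mathcomp Require Import finmap.
From mathcomp Require Import all_classical.

(** A projection [P] is determined by its range, and the range of [P] is
    splitting with orthogonal complement [range (I - P)], because the inner
    product is nondegenerate: [inner (b i) x] is the [i]-th coordinate of [x].
    Conversely the decomposition [x = u + w] with [u] in [U] and [w] in [orth U]
    defines the projection onto a splitting submodule [U].  For projections
    [P <= Q] amounts to [Q \o P = P], and by self-adjointness also to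
    [P \o Q = P]; every order-theoretic claim then becomes a computation with
    [P + Q] and [Q - P]. *)

Import GRing.Theory.
Local Open Scope classical_set_scope.
Local Open Scope ring_scope.

Section Basis.
Context {S : comPzRingType} {M : lmodType S} {I : choiceType} {b : I -> M}.
Hypothesis hb : is_basis b.
Implicit Types (x y z u v : M) (U W : set M) (P Q R : M -> M).

(** * Coordinates with respect to the basis *)

Lemma finite_support_fset (f : I -> S) : finite_set [set i | f i != 0] ->
  exists A : {fset I}, forall i, i \notin A -> f i = 0.
Proof.
move=> /finite_fsetP[A eqA]; exists A => i /negP iA; apply/eqP/negPn/negP => fi.
by apply: iA; have : [set j | f j != 0] i by []; rewrite eqA.
Qed.

Lemma fset_coord_family x (f : I -> S) (A : {fset I}) :
  (forall i, i \notin A -> f i = 0) ->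
  \sum_(i <- A) f i *: b i = x -> coord_family b x f.
Proof.
move=> fA sumf; split; last first.
  by rewrite (fsbigTE A)// => i /fA ->; rewrite scale0r.
apply: (@sub_finite_set _ _ [set` A]); last exact: finite_fset.
by move=> i /= /eqP fi; apply/negPn/negP => /fA.
Qed.

Lemma basis_coordP x : coord_family b x (basis_coord b x).
Proof. by apply: xgetPex; case: hb => _ /(_ x)[f [? _]]; exists f. Qed.

Lemma basis_coord_unique x (f : I -> S) :
  coord_family b x f -> basis_coord b x = f.
Proof.
move=> fx; case: hb => _ /(_ x)[g [_ g_uniq]].
by rewrite -(g_uniq _ fx) -(g_uniq _ (basis_coordP x)).
Qed.

Lemma basis_coord_support x :
  exists A : {fset I}, forall i, i \notin A -> basis_coord b x i = 0.
Proof. by case: (basis_coordP x) => /finite_support_fset. Qed.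

Lemma basis_coordE x (A : {fset I}) :
  (forall i, i \notin A -> basis_coord b x i = 0) ->
  x = \sum_(i <- A) basis_coord b x i *: b i.
Proof.
move=> xA; case: (basis_coordP x) => _ {1}<-.
by rewrite (fsbigTE A)// => i /xA ->; rewrite scale0r.
Qed.

(** Coordinates are unique, so it suffices that the pointwise combination is a coordinate family of
    [a *: x + y]. Joining the two supports lets all sums run over one finite set. *)
Lemma basis_coord_linear a x y i :
  basis_coord b (a *: x + y) i = a * basis_coord b x i + basis_coord b y i.
Proof.
have [A xA] := basis_coord_support x; have [B yB] := basis_coord_support y.
rewrite (@basis_coord_unique _
  (fun i => a * basis_coord b x i + basis_coord b y i))//.
have xAB j : j \notin (A `|` B)%fset -> basis_coord b x j = 0.
  by rewrite inE negb_or => /andP[/xA].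
have yAB j : j \notin (A `|` B)%fset -> basis_coord b y j = 0.
  by rewrite inE negb_or => /andP[_ /yB].
apply: (@fset_coord_family _ _ (A `|` B)%fset) => [j jAB|].
  by rewrite xAB// yAB// mulr0 addr0.
rewrite [in RHS](basis_coordE _ _ xAB) [in RHS](basis_coordE _ _ yAB).
rewrite scaler_sumr -big_split; apply: eq_bigr => j _ /=.
by rewrite scalerDl scalerA.
Qed.

Lemma basis_coord_basis i j : basis_coord b (b i) j = (j == i)%:R.
Proof.
rewrite (@basis_coord_unique _ (fun j => (j == i)%:R))//.
apply: (@fset_coord_family _ _ [fset i]%fset) => [k|].
  by rewrite inE => /negPf ->.
by rewrite big_seq_fset1 eqxx scale1r.
Qed.

(** * The inner product and orthogonal complements *)

Lemma innerE x y (A : {fset I}) :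
  (forall i, i \notin A -> basis_coord b x i = 0) ->
  inner b x y = \sum_(i <- A) basis_coord b x i * basis_coord b y i.
Proof. by move=> xA; rewrite /inner (fsbigTE A)// => i /xA ->; rewrite mul0r. Qed.

Lemma innerC x y : inner b x y = inner b y x.
Proof. by apply: eq_fsbigr => i _; rewrite mulrC. Qed.

Lemma inner_basis i x : inner b (b i) x = basis_coord b x i.
Proof.
rewrite (innerE _ _ [fset i]%fset) => [|j].
  by rewrite big_seq_fset1 basis_coord_basis eqxx mul1r.
by rewrite basis_coord_basis inE => /negPf ->.
Qed.

Lemma inner_linear a x y z :
  inner b z (a *: x + y) = a * inner b z x + inner b z y.
Proof.
have [A zA] := basis_coord_support z.
rewrite !(innerE _ _ _ zA) mulr_sumr -big_split; apply: eq_bigr => i _ /=.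
by rewrite basis_coord_linear mulrDr mulrCA.
Qed.

Lemma innerDr z x y : inner b z (x + y) = inner b z x + inner b z y.
Proof. by have := inner_linear 1 x y z; rewrite scale1r mul1r. Qed.

Lemma inner0r z : inner b z 0 = 0.
Proof. by apply: (addrI (inner b z 0)); rewrite -innerDr !addr0. Qed.

Lemma innerBr z x y : inner b z (x - y) = inner b z x - inner b z y.
Proof. by apply: (addIr (inner b z y)); rewrite -innerDr !subrK. Qed.

(** Testing with [z = b i] already shows that all coordinates agree. *)
Lemma inner_nondegenerate x y : (forall z, inner b z x = inner b z y) -> x = y.
Proof.
move=> xy; have [A xA] := basis_coord_support x.
have yx i : basis_coord b y i = basis_coord b x i by rewrite -!inner_basis xy.
rewrite (basis_coordE _ _ xA) [RHS](basis_coordE _ A) => [|i /xA]; last by rewrite yx.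
by apply: eq_bigr => i _; rewrite yx.
Qed.

Lemma orth_submod U a x y : orth b U x -> orth b U y -> orth b U (a *: x + y).
Proof.
move=> Ux Uy z Uz.
by rewrite innerC inner_linear innerC Ux// mulr0 add0r innerC Uy.
Qed.

Lemma orth0 U : orth b U 0.
Proof. by move=> z _; rewrite innerC inner0r. Qed.

(** * Algebra of projections *)

Section Projection.
Context {P : M -> M}.
Hypothesis projP : projection b P.

Lemma proj_linear a x y : P (a *: x + y) = a *: P x + P y.
Proof. by case: projP => ->. Qed.

Lemma projK x : P (P x) = P x.
Proof. by case: projP => _ PP _; rewrite -[in RHS]PP. Qed.

Lemma proj_adjoint x y : inner b (P x) y = inner b x (P y).
Proof. by case: projP. Qed.

Lemma projD x y : P (x + y) = P x + P y.
Proof. by have := proj_linear 1 x y; rewrite !scale1r. Qed.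

Lemma proj0 : P 0 = 0.
Proof. by apply: (addrI (P 0)); rewrite -projD !addr0. Qed.

Lemma projB x y : P (x - y) = P x - P y.
Proof. by apply: (addIr (P y)); rewrite -projD !subrK. Qed.

Lemma proj_rangeE x : range P x <-> P x = x.
Proof. by split=> [[y _ <-]|<-]; [rewrite projK|exists x]. Qed.

End Projection.

Lemma proj_leE P Q : projection b Q ->
  range P `<=` range Q <-> forall x, Q (P x) = P x.
Proof.
move=> projQ; split=> [PQ x|QP _ [x _ <-]].
  by apply/(proj_rangeE projQ)/PQ; exists x.
by rewrite -QP; exists (P x).
Qed.

(** Taking adjoints reverses the composite and fixes [R]; nondegeneracy turns this into an equality
    of maps. Used with [R = P] for the order and with [R = 0] for orthogonality. *)
Lemma proj_comp_sym {P Q R} : projection b P -> projection b Q ->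
  projection b R -> (forall x, Q (P x) = R x) -> forall x, P (Q x) = R x.
Proof.
move=> projP projQ projR QP x; apply: inner_nondegenerate => z.
by rewrite -(proj_adjoint projP) -(proj_adjoint projQ) QP (proj_adjoint projR).
Qed.

Lemma proj_le_comp P Q : projection b P -> projection b Q ->
  range P `<=` range Q -> forall x, P (Q x) = P x.
Proof.
move=> projP projQ /(proj_leE _ _ projQ); exact: proj_comp_sym.
Qed.

Lemma projection0 : projection b (fun=> 0).
Proof.
by split=> [a x y||x y]; rewrite ?scaler0 ?addr0// inner0r innerC inner0r.
Qed.

Lemma projection_id : projection b idfun.
Proof. by split. Qed.

(** The cross terms in the square of [P + Q] vanish: one by hypothesis, the other by passing to
    adjoints. *)
Lemma projectionD P Q : projection b P -> projection b Q ->
  (forall x, Q (P x) = 0) -> projection b (P \+ Q).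
Proof.
move=> projP projQ QP; have PQ := proj_comp_sym projP projQ projection0 QP.
split=> [a x y||x y] /=.
- by rewrite (proj_linear projP) (proj_linear projQ) scalerDr addrACA.
- apply/funext => x /=.
  by rewrite (projD projP) (projD projQ) !projK// PQ QP addr0 add0r.
- by rewrite innerC !innerDr ![inner b y _]innerC !proj_adjoint.
Qed.

Lemma projectionB P Q : projection b P -> projection b Q ->
  (forall x, Q (P x) = P x) -> projection b (Q \- P).
Proof.
move=> projP projQ QP; have PQ := proj_comp_sym projP projQ projP QP.
split=> [a x y||x y] /=.
- rewrite (proj_linear projP) (proj_linear projQ) scalerBr opprD.
  by rewrite addrACA.
- apply/funext => x /=.
  by rewrite (projB projP) (projB projQ) !projK// PQ QP subrr subr0.
- by rewrite innerC !innerBr ![inner b y _]innerC !proj_adjoint.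
Qed.

Lemma projection_compl P : projection b P -> projection b (idfun \- P).
Proof. by move=> projP; apply: projectionB projP projection_id _. Qed.

Lemma proj_range_inj P Q : projection b P -> projection b Q ->
  range P = range Q -> P = Q.
Proof.
move=> projP projQ eqPQ; apply/funext => x.
have /proj_leE : range P `<=` range Q by rewrite eqPQ.
have /(proj_le_comp _ _ projP projQ) PQ : range P `<=` range Q by rewrite eqPQ.
have /(proj_leE _ _ projP) QP : range Q `<=` range P by rewrite eqPQ.
(* One inclusion gives [P x = P (Q x)] through adjoints, the other gives [P (Q x) = Q x]. *)
by rewrite -PQ QP.
Qed.

(** * Ranges of projections are splitting *)

Lemma orth_range P : projection b P -> orth b (range P) = range (idfun \- P).
Proof.
move=> projP; apply/seteqP; split=> [x Px|_ [x _ <-] _ [y _ <-]] /=; last first.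
  by rewrite -(proj_adjoint projP) (projB projP) projK// subrr innerC inner0r.
suff Px0 : P x = 0 by exists x => //=; rewrite Px0 subr0.
(* The inner product of [z] with [P x] equals that of [P z] with [x], which is 0 because [x] is
   orthogonal to [range P]. *)
apply: inner_nondegenerate => z; rewrite inner0r -(proj_adjoint projP) innerC.
by apply: Px; exists z.
Qed.

(** The decomposition is [x = P x + (x - P x)]; a common element is fixed by both [P] and [I - P],
    hence zero. *)
Lemma splitting_range P : projection b P -> splitting b (range P).
Proof.
move=> projP; split.
- split=> [|a x y]; rewrite !inE; first by exists 0 => //; exact: proj0.
  by move=> [u _ <-] [v _ <-]; exists (a *: u + v) => //; exact: proj_linear.
- apply/seteqP; split=> // x _; rewrite orth_range//.
  by exists (P x); [exists x|exists (x - P x); [exists x|rewrite addrC subrK]].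
- rewrite orth_range//; apply/seteqP; split=> [x [] | _ ->].
    move=> /(proj_rangeE projP) Px /(proj_rangeE (projection_compl _ projP)) /=.
    by rewrite Px subrr => <-.
  split; first by exists 0 => //; exact: proj0.
  by exists 0 => //=; rewrite proj0// subr0.
Qed.

(** * The projection onto a splitting submodule *)

(** The [U]-component of [x]. For splitting [U] such a [u] exists, so the default value 0 never
    matters. *)
Definition splitting_proj U x : M := xget 0 [set u | U u /\ orth b U (x - u)].

Section SplittingProj.
Context {U : set M}.
Hypothesis splitU : splitting b U.

Lemma splitting_linear a x y : U x -> U y -> U (a *: x + y).
Proof.
by case: splitU => -[_ Ulin] _ _ Ux Uy; apply/set_mem/Ulin; apply/mem_set.
Qed.

Lemma splitting_projP x :
  U (splitting_proj U x) /\ orth b U (x - splitting_proj U x).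
Proof.
apply: (@xgetPex _ 0 [set u | U u /\ orth b U (x - u)]).
case: splitU => _ UT _; have : [set: M] x by [].
by rewrite -UT => -[u Uu [w Ww <-]]; exists u; split; rewrite // addrC addKr.
Qed.

(** Two candidates differ by an element of both [U] and [orth b U]. *)
Lemma splitting_proj_unique x u :
  U u -> orth b U (x - u) -> splitting_proj U x = u.
Proof.
move=> Uu Wu; have [Up Wp] := splitting_projP x.
apply/eqP; rewrite -subr_eq0; apply/eqP.
case: splitU => _ _ /seteqP[U0 _]; apply: U0; split.
  by rewrite addrC -scaleN1r; exact: splitting_linear.
have -> : splitting_proj U x - u = -1 *: (x - splitting_proj U x) + (x - u).
  by rewrite scaleN1r opprB addrA subrK.
exact: orth_submod.
Qed.

Lemma projection_splitting_proj : projection b (splitting_proj U).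
Proof.
split=> [a x y||x y].
- have [Ux Wx] := splitting_projP x; have [Uy Wy] := splitting_projP y.
  apply: splitting_proj_unique; first exact: splitting_linear.
  rewrite opprD addrACA -scalerBr; exact: orth_submod.
- apply/funext => x /=; have [Ux _] := splitting_projP x.
  by apply: splitting_proj_unique => //; rewrite subrr; exact: orth0.
- have [Ux Wx] := splitting_projP x; have [Uy Wy] := splitting_projP y.
  (* Each residual is orthogonal to [U], so both sides equal the inner product of the two components
     in [U]. *)
  have /eqP := Wy _ Ux; rewrite innerC innerBr subr_eq0 => /eqP ->.
  have /eqP := Wx _ Uy; rewrite innerC innerBr subr_eq0 [in RHS]innerC => /eqP ->.
  exact: innerC.
Qed.

Lemma range_splitting_proj : range (splitting_proj U) = U.
Proof.
apply/seteqP; split=> [_ [x _ <-]|x Ux]; first by case: (splitting_projP x).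
exists x => //; apply: splitting_proj_unique => //; rewrite subrr; exact: orth0.
Qed.

End SplittingProj.

(** Lets every splitting submodule be replaced by the range of a projection, which carries results
    on [Pr b] over to [Ls b]. *)
Lemma splittingP U : splitting b U <-> exists2 P, projection b P & range P = U.
Proof.
split=> [splitU|[P projP <-]]; last exact: splitting_range.
exists (splitting_proj U); first exact: projection_splitting_proj.
exact: range_splitting_proj.
Qed.

Lemma splitting_proj_range P : projection b P -> splitting_proj (range P) = P.
Proof.
move=> projP; have splitP := splitting_range _ projP.
by apply: proj_range_inj => //; [exact: projection_splitting_proj|
   exact: range_splitting_proj].
Qed.

Lemma splitting_orth U : splitting b U -> splitting b (orth b U).
Proof.
move=> /splittingP[P projP <-]; rewrite orth_range//.
exact/splitting_range/projection_compl.
Qed.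

Lemma splitting_proj_orth U : splitting b U ->
  splitting_proj (orth b U) = idfun \- splitting_proj U.
Proof.
move=> /splittingP[P projP <-]; rewrite orth_range// !splitting_proj_range//.
exact: projection_compl.
Qed.

Lemma range_cst0 : range (fun _ : M => 0 : M) = [set 0].
Proof. by apply/seteqP; split=> [_ [_ _ <-]//|_ ->]; exists 0. Qed.

Lemma range_idfun : range (@idfun M) = [set: M].
Proof. by apply/seteqP; split=> // x _; exists x. Qed.

(** * The orthomodular poset of projections *)

Lemma proj_orthE P Q : projection b P -> projection b Q ->
  range P `<=` range (idfun \- Q) <-> forall x, Q (P x) = 0.
Proof.
move=> projP projQ.
apply: (iff_trans (proj_leE _ _ (projection_compl _ projQ))).
split=> QP x; last by rewrite /= QP subr0.
by have /(congr1 (fun y => P x - y)) := QP x; rewrite /= subKr subrr.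
Qed.

(** An upper bound [R] fixes every [P x] and every [Q x], hence their sum. *)
Lemma is_join_projD P Q : projection b P -> projection b Q ->
  (forall x, Q (P x) = 0) -> is_join (Pr b) P Q (P \+ Q).
Proof.
move=> projP projQ QP; have PQ := proj_comp_sym projP projQ projection0 QP.
have projPQ := projectionD _ _ projP projQ QP.
split=> //.
- by apply/(proj_leE _ _ projPQ) => x /=; rewrite projK// QP addr0.
- by apply/(proj_leE _ _ projPQ) => x /=; rewrite projK// PQ add0r.
- move=> R projR /(proj_leE _ _ projR) RP /(proj_leE _ _ projR) RQ.
  by apply/(proj_leE _ _ projR) => x /=; rewrite (projD projR) RP RQ.
Qed.

(** A lower bound [R] satisfies [Q \o R = R] and [P \o R = 0], so [Q - P] fixes its range. *)
Lemma is_meet_projB P Q : projection b P -> projection b Q ->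
  range P `<=` range Q -> is_meet (Pr b) Q (idfun \- P) (Q \- P).
Proof.
move=> projP projQ lePQ; have QP := (proj_leE _ _ projQ).1 lePQ.
have PQ := proj_le_comp _ _ projP projQ lePQ.
have projQP := projectionB _ _ projP projQ QP.
split=> //.
- by apply/(proj_leE _ _ projQ) => x /=; rewrite (projB projQ) projK// QP.
- by apply/proj_orthE => // x /=; rewrite (projB projP) projK// PQ subrr.
- move=> R projR /(proj_leE _ _ projQ) QR /(proj_orthE _ _ projR projP) PR.
  by apply/(proj_leE _ _ projQP) => x /=; rewrite QR PR subr0.
Qed.

Lemma bounded_poset_Pr : bounded_poset (Pr b).
Proof.
split=> /=.
- exact: projection0.
- exact: projection_id.
- exact: projection_compl.
- by move=> P _.
- by move=> P Q projP projQ PQ QP; apply: proj_range_inj => //; exact/seteqP.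
- by move=> P Q R _ _ _; exact: subset_trans.
- move=> P projP; apply/(proj_leE _ _ projP) => x; exact: proj0.
- by move=> P _; rewrite range_idfun.
Qed.

Lemma orthomodular_poset_Pr : orthomodular_poset (Pr b).
Proof.
split=> /=; first exact: bounded_poset_Pr.
- move=> P Q projP projQ /(proj_le_comp _ _ projP projQ) PQ.
  apply/proj_orthE => // [|x /=]; first exact: projection_compl.
  by rewrite (projB projP) PQ subrr.
- by move=> P _; apply/funext => x /=; rewrite subKr.
- move=> P Q projP projQ /(proj_orthE _ _ projP projQ) QP.
  by exists (P \+ Q); exact: is_join_projD.
- move=> P Q projP projQ lePQ; have QP := (proj_leE _ _ projQ).1 lePQ.
  exists (Q \- P); first exact: is_meet_projB.
  (* Only the claimed join is rewritten: it is then the sum of [P] and [Q - P], which are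
     orthogonal. *)
  have {2}-> : Q = P \+ (Q \- P) by apply/funext => x /=; rewrite addrC subrK.
  apply: is_join_projD => // [|x /=]; first exact: projectionB.
  by rewrite QP projK// subrr.
Qed.

(** * The poset of splitting submodules and its isomorphism with the projections *)

Lemma bounded_poset_Ls : bounded_poset (Ls b).
Proof.
split=> /=.
- by rewrite -range_cst0; exact/splitting_range/projection0.
- by rewrite -range_idfun; exact/splitting_range/projection_id.
- exact: splitting_orth.
- by move=> U _.
- by move=> U W _ _ UW WU; exact/seteqP.
- by move=> U V W _ _ _; exact: subset_trans.
- by move=> U /splittingP[P projP <-] _ ->; exists 0 => //; exact: proj0.
- by [].
Qed.

(** The isomorphism sends [U] to the projection onto it; its inverse takes the range. *)
Lemma oposet_iso_Ls_Pr : oposet_iso (Ls b) (Pr b).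
Proof.
exists splitting_proj; split=> /=.
- split=> [U|U W|P projP].
  + exact: projection_splitting_proj.
  + rewrite !inE => splitU splitW eqUW.
    by rewrite -(range_splitting_proj splitU) eqUW range_splitting_proj.
  + by exists (range P); [exact: splitting_range|exact: splitting_proj_range].
- by move=> U W splitU splitW; rewrite !range_splitting_proj.
- exact: splitting_proj_orth.
- by rewrite -range_cst0 splitting_proj_range//; exact: projection0.
- by rewrite -range_idfun splitting_proj_range//; exact: projection_id.
Qed.

(** For [U = range P] and [W = range Q] orthogonality reads [Q \o P = 0], and [P + Q] has range
    [U + W]; its property as a join passes to ranges. *)
Lemma is_join_addset U W : splitting b U -> splitting b W ->
  U `<=` orth b W -> is_join (Ls b) U W (addset U W).
Proof.
move=> /splittingP[P projP <-] /splittingP[Q projQ <-].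
rewrite orth_range// => /(proj_orthE _ _ projP projQ) QP.
have [projPQ leP leQ lub] := is_join_projD _ _ projP projQ QP.
have -> : addset (range P) (range Q) = range (P \+ Q).
  apply/seteqP; split=> [_ [u Pu [v Qv <-]]|_ [x _ <-]].
    (* The range of [P + Q] is a submodule containing both ranges, hence their sum. *)
    rewrite -[u]scale1r.
    by apply: (splitting_linear (splitting_range _ projPQ)); [exact: leP|exact: leQ].
  by exists (P x); [exists x|exists (Q x); [exists x|]].
split=> //=; first exact: splitting_range.
by move=> _ /splittingP[R projR <-]; exact: lub.
Qed.

End Basis.

Theorem theorem5p8 (S : comPzRingType) (M : lmodType S) (I : choiceType)
    (b : I -> M) (hb : is_basis b) :
  [/\ orthomodular_poset (Pr b),
      bounded_poset (Ls b),
      oposet_iso (Ls b) (Pr b) &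
      forall U W : set M, splitting b U -> splitting b W ->
        U `<=` orth b W -> is_join (Ls b) U W (addset U W)].
Proof.
split.
- exact: orthomodular_poset_Pr.
- exact: bounded_poset_Ls.
- exact: oposet_iso_Ls_Pr.
- exact: is_join_addset.
Qed.
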